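(* Let $n\ge 2$, $1\le t\le n-1$, $N=2^n-1$, $T=2^t-1$, $M=2^{n-t}-1$. Let $C$ be the binary code of length $N$ with parity check matrix $H_{n,t}$, let $\mathcal{D}$ be the triple system on $V=\{1,\dots,N\}$ whose blocks are the supports of all weight-$3$ codewords of $C$, let $V_0$ be the set of indices of zero columns of $H_{n,t}$, and for each nonzero $u\in\mathrm{GF}(2)^{n-t}$ let $G_u$ be the set of indices whose column equals $u$. Let $\mathcal{S}$ be any Steiner triple system on $V$ all of whose blocks are blocks of $\mathcal{D}$, with block set $\mathcal{B}$. Then $\mathcal{B}$ is the disjoint union of: (1) a set $\mathcal{B}_0$ of $T(T-1)/6$ blocks contained in $V_0$ such that $(V_0,\mathcal{B}_0)$ is a Steiner triple system on $V_0$; (2) for each nonzero $u$, a set $\mathcal{B}_u$ of $T(T+1)/2$ blocks each of the form $\{x,y,y'\}$ with $x\in V_0$ and $y,y'\in G_u$; for each $x\in V_0$ there are exactly $(T+1)/2=2^{t-1}$ such blocks containing $x$, the pairs $\{y,y'\}$ occurring in them form a $1$-factor $F^{(u)}_x$ of the complete graph on $G_u$, and the $1$-factors $F^{(u)}_x$ ($x\in V_0$) form a $1$-factorization of this complete graph; (3) for each line $\ell=\{a,b,a+b\}$ of $PG(n-1-t,2)$, a set $\mathcal{B}_\ell$ of $(T+1)^2=2^{2t}$ blocks forming a transversal design $TD[3;T+1]$ on the three groups $G_a,G_b,G_{a+b}$.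
   Context: $H_{n,t}$ is the $(n-t)\times(2^n-1)$ binary matrix obtained from the matrix $H_n$ (whose columns are all distinct nonzero vectors of $\mathrm{GF}(2)^n$) by deleting $t$ rows; its columns consist of every nonzero vector of $\mathrm{GF}(2)^{n-t}$ exactly $2^t$ times and the zero vector exactly $2^t-1$ times. $C=\{c\in\mathrm{GF}(2)^N:H_{n,t}c^T=0\}$. A Steiner triple system on $V$ is a set of $3$-subsets (blocks) such that every $2$-subset of $V$ lies in exactly one block. The points of $PG(n-1-t,2)$ are the nonzero vectors of $\mathrm{GF}(2)^{n-t}$ and its lines are the triples $\{a,b,a+b\}$ with $a\ne b$ nonzero. A transversal design $TD[3;g]$ on three disjoint groups of size $g$ is a set of $3$-subsets each meeting every group in one point such that any two points from different groups lie in exactly one of them. *)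

(* Defs.v *)
From mathcomp Require Import all_boot all_order all_algebra.
Set Implicit Arguments.
Unset Strict Implicit.
Unset Printing Implicit Defensive.
Import GRing.Theory.

Section Designs.
Variable T : finType.
Implicit Types (V G : {set T}) (B F : {set {set T}}).

Definition pairs_of V : {set {set T}} := [set p : {set T} | p \subset V & #|p| == 2].

Definition steiner_triple_system V B : Prop :=
  (forall b, b \in B -> b \subset V /\ #|b| = 3) /\
  (forall p, p \in pairs_of V -> #|[set b in B | p \subset b]| = 1).

(* F is the edge set of a 1-regular spanning subgraph of the complete graph
   on G. *)
Definition one_factor G F : Prop :=
  F \subset pairs_of G /\
  (forall y, y \in G -> #|[set e in F | y \in e]| = 1).

(* The factors are indexed by X; counting indices (rather than factors) also
   makes the factors with distinct indices disjoint. *)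
Definition one_factorization (I : finType) (X : {set I}) G
    (F : I -> {set {set T}}) : Prop :=
  (forall x, x \in X -> one_factor G (F x)) /\
  (forall e, e \in pairs_of G -> #|[set x in X | e \in F x]| = 1).

Definition transversal_design3 (g : nat) (G1 G2 G3 : {set T}) B : Prop :=
  [/\ [/\ #|G1| = g, #|G2| = g & #|G3| = g],
      [/\ [disjoint G1 & G2], [disjoint G1 & G3] & [disjoint G2 & G3]],
      forall b, b \in B -> #|b| = 3 /\
        [/\ #|b :&: G1| = 1, #|b :&: G2| = 1 & #|b :&: G3| = 1]
    & forall x y,
        [|| (x \in G1) && (y \in G2), (x \in G1) && (y \in G3)
          | (x \in G2) && (y \in G3)] ->
        #|[set b in B | [set x; y] \subset b]| = 1].

End Designs.

Section Codes.
Local Open Scope ring_scope.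

(* The order of the columns is left arbitrary. *)
Definition all_nonzero_columns (n : nat) (H : 'M['F_2]_(n, (2 ^ n - 1)%N)) : Prop :=
  [/\ forall j, col j H != 0,
      injective (fun j => col j H)
    & forall v : 'cV['F_2]_n, v != 0 -> exists j, col j H = v].

(* A is H with t of its rows deleted; f is the increasing enumeration of the
   remaining rows. *)
Definition delete_rows (n t N : nat) (H : 'M['F_2]_(n, N))
    (A : 'M['F_2]_((n - t)%N, N)) : Prop :=
  exists2 f : 'I_(n - t) -> 'I_n,
    {homo f : i j / (i < j)%N} & A = rowsub f H.

Variables m N : nat.
Implicit Type A : 'M['F_2]_(m, N).

Definition code A : {set 'rV['F_2]_N} := [set c : 'rV['F_2]_N | A *m c^T == 0].

Definition supp (c : 'rV['F_2]_N) : {set 'I_N} := [set j | c 0 j != 0].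

Definition weight3_supports (C : {set 'rV['F_2]_N}) : {set {set 'I_N}} :=
  [set supp c | c in C & #|supp c| == 3%N].

Definition col_class A (u : 'cV['F_2]_m) : {set 'I_N} := [set j | col j A == u].

Definition pg_lines : {set {set 'cV['F_2]_m}} :=
  [set l : {set 'cV['F_2]_m} | [exists a, exists b,
    [&& a != 0, b != 0, a != b & l == [set a; b; a + b]]]].

End Codes.

(* Main.v *)
(* A weight-3 codeword of C is a triple whose columns sum to zero, so the set of
   columns of a block of B is {0}, {0, u} or a line {a, b, a + b}. Sorting the
   blocks by this set gives B_0, B_u and B_l. The third point of the block
   through x and y lies over the sum of the columns of x and y, so the three
   design properties follow from the Steiner property of B. The cardinalities
   follow by counting ordered pairs of points against blocks, once the number of
   indices over each u is known: deleting t rows is a linear surjection, whose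
   fibres all have 2^t elements, and the one over 0 contains the zero vector,
   which is not a column of H. *)

Require Import Defs.
From mathcomp Require Import all_boot all_order all_algebra.
Set Implicit Arguments.
Unset Strict Implicit.
Unset Printing Implicit Defensive.
Import GRing.Theory.
Local Open Scope ring_scope.

(** * Blocks through two points and double counting in a Steiner triple system *)

Section Triples.
Local Open Scope nat_scope.

Variables (I : finType) (B : {set {set I}}).
Hypothesis steinerB : steiner_triple_system [set: I] B.

Lemma set2_subset (x y : I) (b : {set I}) :
  ([set x; y] \subset b) = (x \in b) && (y \in b).
Proof. by rewrite subUset !sub1set. Qed.

Lemma sts_card3 b : b \in B -> #|b| = 3%N.
Proof. by move=> /(proj1 steinerB)[]. Qed.

Lemma sts_blockP x y : x != y ->
  exists b, [/\ b \in B, x \in b, y \in b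
    & forall c, c \in B -> x \in c -> y \in c -> c = b].
Proof.
move=> nxy; have /(proj2 steinerB)/eqP/cards1P[b Eb]: [set x; y] \in pairs_of [set: I].
  by rewrite inE subsetT cards2 nxy.
have in_Eb c : (c \in B) && ((x \in c) && (y \in c)) = (c == b).
  by rewrite -set2_subset; move/setP/(_ c): Eb; rewrite !inE.
exists b; have /and3P[-> -> ->]: [&& b \in B, x \in b & y \in b] by rewrite in_Eb.
by split=> // c Bc xc yc; apply/eqP; rewrite -in_Eb Bc xc.
Qed.

Lemma card3_third (b : {set I}) x y : #|b| = 3%N -> x != y -> x \in b -> y \in b ->
  exists z, [/\ x != z, y != z & b = [set x; y; z]].
Proof.
move=> b3 nxy xb yb.
have: #|b :\: [set x; y]| == 1%N.
  by rewrite cardsDS ?set2_subset ?xb // b3 cards2 nxy.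
case/cards1P=> z Ez; exists z.
have: z \in b :\: [set x; y] by rewrite Ez inE.
rewrite !inE negb_or => /andP[/andP[zx zy] zb].
split; rewrite 1?eq_sym //; apply/setP=> w.
by move/setP/(_ w): Ez; rewrite !inE => <-; do 2![case: eqP => [->|_] /=; rewrite ?xb ?yb //].
Qed.

Lemma sts_thirdP x y : x != y ->
  exists z, [/\ x != z, y != z, [set x; y; z] \in B
    & forall c, c \in B -> x \in c -> y \in c -> c = [set x; y; z]].
Proof.
move=> nxy; have [b [Bb xb yb Ub]] := sts_blockP nxy.
have [z [xz yz Eb]] := card3_third (sts_card3 Bb) nxy xb yb.
by exists z; rewrite -Eb; split.
Qed.

(** Double counting of incidences: the block of [C] through a pair in [P] exists by the covering
    hypothesis and is unique because [C] lies in [B]. All the block counts below are instances of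
    this. *)
Lemma sts_count_pairs (P : {set I * I}) (C : {set {set I}}) k :
    C \subset B -> (forall p, p \in P -> p.1 != p.2) ->
    (forall p, p \in P -> exists2 b, b \in C & (p.1 \in b) && (p.2 \in b)) ->
    (forall b, b \in C -> #|P :&: setX b b| = k) ->
  #|P| = (#|C| * k)%N.
Proof.
move=> /subsetP sCB neqP coverP cardP; rewrite -sum_nat_const -(eq_bigr _ cardP).
(* Each pair contributes 1, written as a sum over the single block of [C] containing it; the two
   sums are then exchanged. *)
rewrite -sum1_card (eq_bigr (fun p => \sum_(b in C | p \in setX b b) 1))%N; last first.
  move=> p Pp; have [b Cb /andP[p1b p2b]] := coverP _ Pp.
  rewrite (big_pred1 b) // => c; rewrite !inE.
  apply/and3P/eqP => [[Cc p1c p2c] | ->]; last by split.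
  have [d [_ _ _ Ud]] := sts_blockP (neqP _ Pp).
  by rewrite (Ud c (sCB c Cc) p1c p2c) (Ud b (sCB b Cb) p1b p2b).
rewrite (exchange_big_dep (mem C)) /=; last by move=> p b _ /andP[].
apply: eq_bigr => b Cb; rewrite -sum1_card; apply: eq_bigl => p.
by rewrite Cb !inE.
Qed.

Lemma sts_count_setX (X Y : {set I}) (C : {set {set I}}) k :
    C \subset B -> [disjoint X & Y] ->
    (forall x y, x \in X -> y \in Y -> exists2 b, b \in C & (x \in b) && (y \in b)) ->
    (forall b, b \in C -> (#|b :&: X| * #|b :&: Y| = k)%N) ->
  (#|X| * #|Y| = #|C| * k)%N.
Proof.
move=> sCB dXY coverC cardC; rewrite -cardsX; apply: sts_count_pairs => //.
- case=> x y /setXP[/= Xx Yy]; apply: contraTneq dXY => Exy.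
  by rewrite disjoint_subset; apply/subsetPn; exists x; rewrite // inE Exy Yy.
- by case=> x y /setXP[/= Xx Yy]; apply: coverC.
move=> b /cardC <-; rewrite -cardsX; apply: eq_card => -[x y]; rewrite !inE /=.
by rewrite andbACA [_ && (x \in b)]andbC [_ && (y \in b)]andbC.
Qed.

End Triples.

(** * Steiner triple systems whose points carry labels in a group of exponent two, the labels of
    each block summing to zero *)

Section GradedTriples.
Local Open Scope nat_scope.

Variables (I : finType) (U : finZmodType) (phi : I -> U) (B : {set {set I}}).
Hypothesis addUU : forall u : U, (u + u = 0)%R.
Hypothesis steinerB : steiner_triple_system [set: I] B.
Hypothesis sum_block : forall b, b \in B -> (\sum_(j in b) phi j = 0)%R.

Definition fiber u : {set I} := [set j | phi j == u].
(** One family serves all three kinds of blocks: [K] will be [{0}], [{0, u}] or a line. Disjointness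
    of two kinds then reduces to inequality of the label sets. *)
Definition blocks_over (K : {set U}) : {set {set I}} := [set b in B | phi @: b == K].

(** A projective line only when [a] and [b] are distinct and nonzero. The degenerate cases collapse
    to [{0}] or [{0, u}], so that one formula gives the label set of the block through any two
    points. *)
Local Notation line a b := [set a; b; (a + b)%R].

Lemma in_blocks_over K b : b \in blocks_over K -> b \in B.
Proof. by rewrite inE => /andP[]. Qed.

Lemma blocks_over_sub K : blocks_over K \subset B.
Proof. exact/subsetP/in_blocks_over. Qed.

Lemma disjoint_blocks_over K L : K != L -> [disjoint blocks_over K & blocks_over L].
Proof.
move=> nKL; rewrite disjoint_subset; apply/subsetP=> b; rewrite !inE => /andP[-> /eqP->].
exact: nKL.
Qed.

Lemma disjoint_fiber u v : u != v -> [disjoint fiber u & fiber v].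
Proof.
by move=> nuv; rewrite disjoint_subset; apply/subsetP=> x; rewrite !inE => /eqP->.
Qed.

Lemma fiber_neq u v x y : u != v -> x \in fiber u -> y \in fiber v -> x != y.
Proof.
by rewrite !inE => nuv /eqP xu /eqP yv; apply: contraNneq nuv => E; rewrite -xu E yv.
Qed.

Lemma addUK (u v : U) : (u + (u + v) = v)%R.
Proof. by rewrite addrA addUU add0r. Qed.

Lemma add_neq0 (u v : U) : u != v -> (u + v)%R != 0%R.
Proof. by apply: contraNneq => E; rewrite -(addUK u v) E addr0. Qed.

Lemma add_eql (u v : U) : ((u + v)%R == u) = (v == 0%R).
Proof. by rewrite -subr_eq0 addrAC subrr add0r. Qed.

Lemma imset_set3 (x y z : I) : phi @: [set x; y; z] = [set phi x; phi y; phi z].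
Proof. by rewrite !imsetU !imset_set1. Qed.

(** The three labels of a block sum to zero and every label is its own opposite, so two points of a
    block determine the third label, hence the whole label set. *)
Lemma graded_thirdP x y : x != y ->
  exists z, [/\ x != z, y != z, phi z = (phi x + phi y)%R,
      [set x; y; z] \in blocks_over (line (phi x) (phi y))
    & forall c, c \in B -> x \in c -> y \in c -> c = [set x; y; z]].
Proof.
move=> nxy; have [z [nxz nyz Bz Uz]] := sts_thirdP steinerB nxy.
have phiz : phi z = (phi x + phi y)%R.
  move: (sum_block Bz); rewrite -setUA big_setU1 /=; last by rewrite !inE negb_or nxy.
  rewrite big_setU1 ?inE // big_set1 addrA => E.
  by rewrite -(addUK (phi x + phi y)%R (phi z)) E addr0.
by exists z; split=> //; rewrite inE Bz imset_set3 phiz eqxx.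
Qed.

Lemma block_over_pair x y : x != y ->
  exists2 b, b \in blocks_over (line (phi x) (phi y)) & (x \in b) && (y \in b).
Proof.
move=> nxy; have [z [_ _ _ Bz _]] := graded_thirdP nxy.
by exists [set x; y; z] => //; rewrite !inE !eqxx orbT.
Qed.

(** The unique block of [B] through [x] and [y] already lies in this family, so the Steiner property
    passes to each kind of block separately. *)
Lemma card_blocks_over_pair x y : x != y ->
  #|[set b in blocks_over (line (phi x) (phi y)) | [set x; y] \subset b]| = 1.
Proof.
move=> nxy; have [z [_ _ _ Bz Uz]] := graded_thirdP nxy.
apply/eqP/cards1P; exists [set x; y; z]; apply/setP=> b.
rewrite inE set2_subset inE; apply/and3P/eqP => [[Bb xb yb] | ->].
  exact: Uz (in_blocks_over Bb) _ _.
by rewrite Bz !inE !eqxx orbT.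
Qed.

Lemma line00 : line (0%R : U) 0%R = [set 0%R].
Proof. by rewrite addr0 !setUid. Qed.

Lemma line0u (u : U) : line 0%R u = [set 0%R; u].
Proof. by rewrite add0r -setUA setUid. Qed.

Lemma lineuu (u : U) : line u u = [set 0%R; u].
Proof. by rewrite addUU setUid setUC. Qed.

(** Two points of the block are chosen; the cases are whether their labels vanish and, if neither
    does, whether they coincide. *)
Lemma blockP b : b \in B ->
  [\/ b \in blocks_over [set 0%R],
      exists2 u, u != 0%R & b \in blocks_over [set 0%R; u]
    | exists u v, [/\ u != 0%R, v != 0%R, u != v & b \in blocks_over (line u v)]].
Proof.
move=> Bb; have /card_gt1P[x [y [xb yb nxy]]] : 1 < #|b| by rewrite (sts_card3 steinerB).
have [z [_ _ _ Bz Uz]] := graded_thirdP nxy.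
rewrite -{}(Uz b) // in Bz.
have [x0|x0] := eqVneq (phi x) 0%R; have [y0|y0] := eqVneq (phi y) 0%R.
- by apply: Or31; rewrite x0 y0 line00 in Bz.
- by apply: Or32; exists (phi y); rewrite // x0 line0u in Bz.
- by apply: Or32; exists (phi x); rewrite // y0 addr0 setUAC setUid setUC in Bz.
have [xy|xy] := eqVneq (phi x) (phi y); last by apply: Or33; exists (phi x), (phi y).
by apply: Or32; exists (phi x); rewrite // -xy lineuu in Bz.
Qed.

Lemma line_neq0 (u v w : U) : u != 0%R -> v != 0%R -> u != v -> w \in line u v -> w != 0%R.
Proof. by move=> u0 v0 uv; rewrite !inE -orbA => /or3P[] /eqP-> //; apply: add_neq0. Qed.

Lemma sub_fiber0 b : b \in B -> (phi @: b == [set 0%R]) = (b \subset fiber 0%R).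
Proof.
move=> Bb; apply/eqP/subsetP => [E x xb | sb0].
  by rewrite inE -in_set1 -E imset_f.
(* A point of [b] is required: an empty set would lie in the fiber, but its image would be empty
   rather than [[set 0]]. *)
have /card_gt1P[x [_ [xb _ _]]] : 1 < #|b| by rewrite (sts_card3 steinerB).
apply/eqP; rewrite eqEsubset; apply/andP; split.
  by apply/subsetP=> _ /imsetP[y /sb0 y0 ->]; rewrite inE in y0; rewrite inE.
by rewrite sub1set; move/sb0: (xb); rewrite inE => /eqP <-; rewrite imset_f.
Qed.

(** * Blocks inside the zero fiber: the Steiner subsystem *)

Lemma steiner_over0 : steiner_triple_system (fiber 0%R) (blocks_over [set 0%R]).
Proof.
split=> [b|p].
  by rewrite inE => /andP[Bb]; rewrite sub_fiber0 // => ->; rewrite (sts_card3 steinerB).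
rewrite inE => /andP[sp /cards2P[x [y [nxy Ep]]]]; move: sp.
rewrite Ep set2_subset !inE => /andP[/eqP x0 /eqP y0].
by have := card_blocks_over_pair nxy; rewrite x0 y0 line00.
Qed.

(** Ordered pairs of distinct points of the zero fiber are counted by blocks; each block contains 3
    * 2 = 6 of them. *)
Lemma card_blocks_over0 :
  6 * #|blocks_over [set 0%R]| = #|fiber 0%R| * (#|fiber 0%R| - 1).
Proof.
set V := fiber 0%R; pose D (W : {set I}) := setX W W :\: [set (x, x) | x in W].
have cardD W : #|D W| = #|W| * (#|W| - 1).
  rewrite cardsDS; last by apply/subsetP=> _ /imsetP[x xW ->]; rewrite !inE xW.
  by rewrite cardsX card_imset ?mulnBr ?muln1 // => x y [].
have inD W (x y : I) : ((x, y) \in D W) = [&& x != y, x \in W & y \in W].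
  rewrite !inE /=; apply/andP/and3P=> [[nxy /andP[xW yW]] | [nxy xW yW]]; split=> //.
  - by apply: contraNneq nxy => ->; rewrite imset_f.
  - by apply: contraNN nxy => /imsetP[z _ [-> ->]].
  by rewrite xW.
rewrite -cardD mulnC.
apply/esym/(sts_count_pairs steinerB) => [|[x y]|[x y]|b].
- exact: blocks_over_sub.
- by rewrite inD => /andP[].
- rewrite inD !inE => /and3P[nxy /eqP x0 /eqP y0].
  by have := block_over_pair nxy; rewrite x0 y0 line00.
rewrite inE => /andP[Bb]; rewrite sub_fiber0 // => /subsetP sb.
have <- : #|D b| = 6 by rewrite cardD (sts_card3 steinerB Bb).
apply: eq_card => -[x y]; rewrite inE inD [in RHS]inD in_setX -/V /=.
apply/andP/and3P => [[/and3P[nxy _ _] /andP[xb yb]] | [nxy xb yb]]; split=> //.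
  by rewrite nxy !sb.
by rewrite xb.
Qed.

(** * Blocks with labels 0 and [u]: the one-factorization *)

Lemma block_over2P u b : u != 0%R -> b \in blocks_over [set 0%R; u] ->
  exists x y y', [/\ x \in fiber 0%R, y \in fiber u, y' \in fiber u, y != y'
    & b = [set x; y; y']].
Proof.
move=> u0; rewrite inE => /andP[Bb /eqP Eb].
have /imsetP[x xb x0] : 0%R \in phi @: b by rewrite Eb !inE eqxx.
have /imsetP[y yb yu] : u \in phi @: b by rewrite Eb !inE eqxx orbT.
have nxy : x != y by apply: contraNneq u0 => E; rewrite yu -E -x0.
(* With one point over 0 and one over [u], the third lies over [0 + u = u]. *)
have [z [_ nyz phiz _ Uz]] := graded_thirdP nxy.
exists x, y, z; split=> //; rewrite ?inE.
- by rewrite -x0.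
- by rewrite -yu.
- by rewrite phiz -x0 -yu add0r.
exact: Uz.
Qed.

Lemma block_over2_meet u x y y' : u != 0%R ->
    x \in fiber 0%R -> y \in fiber u -> y' \in fiber u ->
  [set x; y; y'] :&: fiber 0%R = [set x] /\ [set x; y; y'] :&: fiber u = [set y; y'].
Proof.
rewrite !inE => u0 /eqP x0 /eqP yu /eqP yu'.
split; apply/setP=> w; rewrite !inE.
  have [->|_] := eqVneq w x; first by rewrite x0 eqxx.
  have [->|_] := eqVneq w y; first by rewrite yu (negPf u0).
  by have [->|_] := eqVneq w y'; first by rewrite yu' (negPf u0).
have [->|_] := eqVneq w y; first by rewrite yu eqxx orbT.
have [->|_] := eqVneq w y'; first by rewrite yu' eqxx orbT.
have [->|//] := eqVneq w x.
by rewrite x0 eq_sym (negPf u0).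
Qed.

Lemma block_over2_card u b : u != 0%R -> b \in blocks_over [set 0%R; u] ->
  #|b :&: fiber 0%R| = 1 /\ #|b :&: fiber u| = 2.
Proof.
move=> u0 /(block_over2P u0)[x [y [y' [x0 yu yu' nyy' ->]]]].
by have [-> ->] := block_over2_meet u0 x0 yu yu'; rewrite cards1 cards2 nyy'.
Qed.

Lemma cover_over2 u x y : u != 0%R -> x \in fiber 0%R -> y \in fiber u ->
  exists2 b, b \in blocks_over [set 0%R; u] & (x \in b) && (y \in b).
Proof.
rewrite eq_sym => u0 x0 yu; have := block_over_pair (fiber_neq u0 x0 yu).
by move: x0 yu; rewrite !inE => /eqP-> /eqP->; rewrite line0u.
Qed.

(** Each pair in [fiber 0] times [fiber u] lies in one such block, and a block contains 1 * 2 of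
    these pairs. *)
Lemma card_blocks_over2 u : u != 0%R ->
  2 * #|blocks_over [set 0%R; u]| = #|fiber 0%R| * #|fiber u|.
Proof.
move=> u0; rewrite mulnC; apply/esym/(sts_count_setX steinerB).
- exact: blocks_over_sub.
- by rewrite disjoint_fiber 1?eq_sym.
- by move=> x y; apply: cover_over2.
by move=> b /(block_over2_card u0)[-> ->].
Qed.

Lemma card_blocks_over2_at u x : u != 0%R -> x \in fiber 0%R ->
  2 * #|[set b in blocks_over [set 0%R; u] | x \in b]| = #|fiber u|.
Proof.
(* The same count with the zero fiber replaced by the singleton of [x]. *)
move=> u0 x0; rewrite mulnC -[RHS]mul1n -(cards1 x); apply/esym/(sts_count_setX steinerB).
- by apply/subsetP=> b; rewrite inE => /andP[/in_blocks_over].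
- by rewrite disjoints1 !inE; move: x0; rewrite inE => /eqP->; rewrite eq_sym.
- move=> x' y /set1P-> yu; have [b Bb /andP[xb yb]] := cover_over2 u0 x0 yu.
  by exists b; [rewrite in_set Bb | rewrite xb].
move=> b; rewrite inE => /andP[/(block_over2_card u0)[_ ->] xb].
have -> : b :&: [set x] = [set x] by apply/setIidPr; rewrite sub1set.
by rewrite cards1.
Qed.

(** The edge set $F^{(u)}_x$ of the theorem. *)
Definition factor u x := [set b :\ x | b in blocks_over [set 0%R; u] & x \in b].

Lemma in_factor u x e :
  (e \in factor u x) = (x \notin e) && (x |: e \in blocks_over [set 0%R; u]).
Proof.
apply/imsetP/andP => [[b] | [xe Be]].
  by rewrite inE => /andP[Bb xb] ->; rewrite setD1K // setD11.
by exists (x |: e); [rewrite inE Be setU11 | rewrite setU1K].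
Qed.

Lemma factor_sub_pairs u x : u != 0%R -> x \in fiber 0%R ->
  factor u x \subset pairs_of (fiber u).
Proof.
move=> u0 x0; apply/subsetP=> e; rewrite in_factor => /andP[xe Be].
have [z [y [y' [z0 yu yu' nyy' Ee]]]] := block_over2P u0 Be.
have [] := block_over2_meet u0 z0 yu yu'; rewrite -Ee => /setP/(_ x) Ez Ey.
(* Both [x] and [z] are points of the block over 0, and there is only one such point; so [x = z],
   and removing it leaves the two points over [u]. *)
have -> : e = [set y; y'].
  move: Ez; rewrite !inE eqxx /=; move: (x0); rewrite inE => -> /esym/eqP Exz.
  have nzy : z \notin [set y; y'].
    by rewrite eq_sym in u0; rewrite !inE negb_or !(fiber_neq u0 z0).
  by rewrite -(setU1K xe) Ee -setUA Exz setU1K.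
by rewrite inE set2_subset yu yu' cards2 nyy'.
Qed.

(** The edge at [y] comes from the block through [x] and [y]; its other end is the third point of
    that block. *)
Lemma one_factor_over2 u x : u != 0%R -> x \in fiber 0%R ->
  one_factor (fiber u) (factor u x).
Proof.
move=> u0 x0; split; first exact: factor_sub_pairs.
move=> y yu; have nxy : x != y by apply: fiber_neq x0 yu; rewrite eq_sym.
have [z [nxz nyz _ Bz Uz]] := graded_thirdP nxy.
have nx : x \notin [set y; z] by rewrite !inE negb_or nxy.
apply/eqP/cards1P; exists [set y; z]; apply/setP=> e; rewrite inE in_factor [RHS]inE.
apply/andP/eqP => [[/andP[xe Be] ye] | ->].
  rewrite -(setU1K xe) (Uz (x |: e)) ?inE ?eqxx ?ye ?orbT //; last first.
    exact: in_blocks_over Be.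
  by rewrite -setUA setU1K.
move: x0 yu Bz; rewrite nx !inE eqxx !setUA => /eqP-> /eqP->.
by rewrite line0u.
Qed.

(** The third point of the block through [y] and [y'] lies over [u + u = 0]; it is the one index
    whose factor contains this edge. *)
Lemma one_factorization_over2 u : u != 0%R ->
  one_factorization (fiber 0%R) (fiber u) (factor u).
Proof.
move=> u0; split=> [x|e]; first exact: one_factor_over2.
rewrite inE => /andP[se /cards2P[y [y' [nyy' Ee]]]]; move: se.
rewrite {e}Ee set2_subset => /andP[yu yu'].
have [x [nyx nyx' phix Bx Ux]] := graded_thirdP nyy'.
move: (yu) (yu') phix Bx; rewrite ![_ \in fiber u]inE => /eqP-> /eqP->.
rewrite lineuu addUU => x0 Bx.
have EU w : w |: [set y; y'] = [set y; y'; w] by rewrite setUC.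
apply/eqP/cards1P; exists x; apply/setP=> w; rewrite 2!inE in_factor EU [RHS]inE.
apply/andP/eqP => [[w0 /andP[wn Bw]] | ->].
  have E: [set y; y'; w] = [set y; y'; x].
    by apply: Ux; rewrite ?inE ?eqxx ?orbT //; apply: in_blocks_over Bw.
  have : w \in [set y; y'; x] by rewrite -E !inE eqxx orbT.
  by rewrite inE (negPf wn) inE => /eqP.
by rewrite Bx !inE x0 eqxx negb_or ![x == _]eq_sym nyx nyx'.
Qed.

(** * Blocks over lines: transversal designs *)

Lemma card_line (u v : U) : u != 0%R -> v != 0%R -> u != v -> #|line u v| = 3.
Proof.
move=> u0 v0 uv; rewrite setUC cardsU1 cards2 uv !inE negb_or.
by rewrite add_eql v0 [(u + v)%R]addrC add_eql u0.
Qed.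

(** The block and its label set both have three elements, so [phi] is injective on the block. *)
Lemma line_block_meet u v w b : u != 0%R -> v != 0%R -> u != v ->
  b \in blocks_over (line u v) -> w \in line u v -> #|b :&: fiber w| = 1.
Proof.
move=> u0 v0 uv; rewrite inE => /andP[Bb /eqP Eb].
have /imset_injP inj : #|phi @: b| == #|b| by rewrite Eb card_line ?(sts_card3 steinerB).
rewrite -Eb => /imsetP[x xb ->]; apply/eqP/cards1P; exists x; apply/setP=> y.
rewrite !inE; apply/andP/eqP => [[yb /eqP]|-> //]; exact: inj.
Qed.

Lemma card_blocks_over_line u v : u != 0%R -> v != 0%R -> u != v ->
  #|blocks_over (line u v)| = #|fiber u| * #|fiber v|.
Proof.
move=> u0 v0 uv; rewrite -[LHS]muln1; apply/esym/(sts_count_setX steinerB).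
- exact: blocks_over_sub.
- exact: disjoint_fiber.
- move=> x y xu yv; have := block_over_pair (fiber_neq uv xu yv).
  by move: xu yv; rewrite !inE => /eqP-> /eqP->.
by move=> b Bb; rewrite !(@line_block_meet u v) // !inE eqxx ?orbT.
Qed.

Lemma transversal_over_line g u v : u != 0%R -> v != 0%R -> u != v ->
    (forall w, w != 0%R -> #|fiber w| = g) ->
  transversal_design3 g (fiber u) (fiber v) (fiber (u + v)%R) (blocks_over (line u v)).
Proof.
move=> u0 v0 uv cardG; have w0 := add_neq0 uv.
have uw : u != (u + v)%R by rewrite eq_sym add_eql.
have vw : v != (u + v)%R by rewrite eq_sym addrC add_eql.
split; first by rewrite !cardG.
- by rewrite !disjoint_fiber.
- move=> b Bb; split; first by rewrite (sts_card3 steinerB) // (in_blocks_over Bb).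
  by rewrite !(@line_block_meet u v) // !inE eqxx ?orbT.
(* Any two of the three labels span the same line, so one family of blocks covers the pairs from all
   three choices of two groups. *)
have line_uw : line u (u + v)%R = line u v by rewrite addUK setUAC.
have line_vw : line v (u + v)%R = line u v.
  by rewrite [(u + v)%R]addrC addUK setUC setUA.
move=> x y /or3P[] /andP[xG yG].
- have := card_blocks_over_pair (fiber_neq uv xG yG).
  by move: xG yG; rewrite !inE => /eqP-> /eqP->.
- have := card_blocks_over_pair (fiber_neq uw xG yG).
  by move: xG yG; rewrite !inE => /eqP-> /eqP->; rewrite line_uw.
have := card_blocks_over_pair (fiber_neq vw xG yG).
by move: xG yG; rewrite !inE => /eqP-> /eqP->; rewrite line_vw.
Qed.

End GradedTriples.

(** * Multiplicities of the columns after deletion of rows *)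

Lemma card_rowsub_fiber (m n : nat) (f : 'I_m -> 'I_n) (u : 'cV['F_2]_m) :
  injective f -> #|[set v : 'cV['F_2]_n | rowsub f v == u]| = (2 ^ (n - m))%N.
Proof.
move=> injf; pose K (w : 'cV['F_2]_m) := [set v : 'cV['F_2]_n | rowsub f v == w].
have card_cV k : #|{: 'cV['F_2]_k}| = (2 ^ k)%N by rewrite card_mx card_Fp // muln1.
have surj (w : 'cV['F_2]_m) : {v : 'cV['F_2]_n | rowsub f v = w}.
  (* The preimage places the entries of [w] in the rows selected by [f] and the default 0 in the
     others. *)
  exists (\col_i oapp (fun j => w j 0) 0 [pick j | f j == i]).
  apply/colP=> j; rewrite !mxE; case: pickP => [k /eqP/injf -> //|/(_ j)].
  by rewrite eqxx.
have cardK w : #|K w| = #|K u|.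
  (* Translation by [- d] carries the fibre over [w] onto the fibre over [u]. The [2 ^ m] fibres
     thus have equal size and partition [2 ^ n] vectors. *)
  have [d Ed] := surj (w - u).
  rewrite -(card_imset _ (addIr (- d))); apply: eq_card => v.
  apply/imsetP/idP => [[x]|].
    by rewrite !inE => /eqP Ex ->; rewrite linearB /= Ex Ed opprB addrC subrK.
  rewrite inE => /eqP Ev; exists (v + d); rewrite ?addrK // inE.
  by rewrite linearD /= Ev Ed addrC subrK.
have le_mn : (m <= n)%N by have := leq_card f injf; rewrite !card_ord.
have Ecard : #|{: 'cV['F_2]_n}| = (\sum_(w : 'cV['F_2]_m) #|K w|)%N.
  rewrite -sum1_card (partition_big (rowsub f) predT) //=.
  by apply: eq_bigr => w _; rewrite -sum1_card; apply: eq_bigl => v; rewrite !inE.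
apply/eqP; rewrite -(eqn_pmul2l (_ : 0 < 2 ^ m)%N) ?expn_gt0 // -expnD subnKC //.
by rewrite -(card_cV n) Ecard (eq_bigr _ (fun w _ => cardK w)) sum_nat_const card_cV.
Qed.

(** The columns of [H] list each nonzero vector once, so the class of [u] corresponds to the nonzero
    vectors in its fibre. The boolean [u == 0], read as 0 or 1, accounts for the zero vector, which
    lies only in the fibre over 0. *)
Lemma card_col_class (n t : nat) (H : 'M['F_2]_(n, (2 ^ n - 1)%N))
    (A : 'M['F_2]_((n - t)%N, (2 ^ n - 1)%N)) (u : 'cV['F_2]_(n - t)) :
    (t <= n)%N -> all_nonzero_columns H -> delete_rows H A ->
  #|col_class A u| = (2 ^ t - (u == 0%R))%N.
Proof.
move=> le_tn [H0 injH surjH] [f monof ->].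
have injf : injective f.
  by move=> i j Eij; case: (ltngtP i j) => [/monof|/monof|/val_inj//]; rewrite Eij ltnn.
have col_rowsub j : col j (rowsub f H) = rowsub f (col j H) by apply/colP=> i; rewrite !mxE.
have := card_rowsub_fiber u injf; rewrite subKn // => <-.
rewrite -(card_imset _ injH) (cardsD1 0 [set v | _]) inE linear0 eq_sym addKn.
apply: eq_card => v; rewrite !inE; apply/imsetP/andP => [[j]|[v0 Ev]].
  by rewrite inE => Ej ->; rewrite H0 -col_rowsub.
by have [j Ej] := surjH v v0; exists j => //; rewrite inE col_rowsub Ej.
Qed.

(** * From codewords to zero column sums over GF(2) *)

Lemma F2_eq1 (x : 'F_2) : x != 0 -> x = 1.
Proof. by case: x => -[|[|k]] // lt_k _; apply: val_inj. Qed.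

(** A binary codeword equals 1 on its support and 0 elsewhere, so its syndrome is the sum of the
    columns indexed by the support. *)
Lemma sum_weight3_support (m N : nat) (A : 'M['F_2]_(m, N)) (b : {set 'I_N}) :
  b \in weight3_supports (code A) -> \sum_(j in b) col j A = 0.
Proof.
case/imsetP=> c; rewrite !inE => /andP[/eqP Ac _] ->.
apply/colP=> i; rewrite summxE mxE; move/colP/(_ i): Ac; rewrite !mxE => Ai; rewrite -[RHS]Ai.
rewrite [RHS](bigID (mem (supp c))) /= [X in _ + X]big1 ?addr0 => [|j].
  apply: eq_bigr => j; rewrite inE !mxE.
  by move/F2_eq1->; rewrite mulr1.
by rewrite inE negbK mxE => /eqP->; rewrite mulr0.
Qed.

Lemma F2_col_addxx (m : nat) (u : 'cV['F_2]_m) : u + u = 0.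
Proof. by rewrite -mulr2n -scaler_nat pchar_Fp_0 // scale0r. Qed.

Theorem theorem2p8 (n t : nat) (hn : (2 <= n)%N) (ht : (1 <= t <= n - 1)%N)
  (H : 'M['F_2]_(n, (2 ^ n - 1)%N)) (hH : all_nonzero_columns H)
  (Hnt : 'M['F_2]_((n - t)%N, (2 ^ n - 1)%N)) (hHnt : delete_rows H Hnt)
  (B : {set {set 'I_(2 ^ n - 1)}})
  (hB : steiner_triple_system [set: 'I_(2 ^ n - 1)] B)
  (hBD : B \subset weight3_supports (code Hnt)) :
  let T := (2 ^ t - 1)%N in
  let V0 := col_class Hnt 0 in
  let G := col_class Hnt in
  exists (B0 : {set {set 'I_(2 ^ n - 1)}})
         (Bp : 'cV['F_2]_(n - t) -> {set {set 'I_(2 ^ n - 1)}})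
         (Bl : {set 'cV['F_2]_(n - t)} -> {set {set 'I_(2 ^ n - 1)}}),
    (* disjoint union *)
    [/\ B = B0 :|: \bigcup_(u | u != 0) Bp u
               :|: \bigcup_(l in pg_lines (n - t)) Bl l,
        (forall u, u != 0 -> [disjoint B0 & Bp u]) /\
        (forall l, l \in pg_lines (n - t) -> [disjoint B0 & Bl l]),
        forall u v, u != 0 -> v != 0 -> u != v -> [disjoint Bp u & Bp v],
        forall u l, u != 0 -> l \in pg_lines (n - t) -> [disjoint Bp u & Bl l]
      & forall l k, l \in pg_lines (n - t) -> k \in pg_lines (n - t) ->
          l != k -> [disjoint Bl l & Bl k]] /\
    [/\ (* (1) *)
        (6 * #|B0| = T * (T - 1))%N /\ steiner_triple_system V0 B0,
        (* (2) *)
        forall u, u != 0 ->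
          let F x := [set b :\ x | b in Bp u & x \in b] in
          [/\ (2 * #|Bp u| = T * (T + 1))%N,
              forall b, b \in Bp u -> exists x y y',
                [/\ x \in V0, y \in G u, y' \in G u, y != y'
                  & b = [set x; y; y']],
              forall x, x \in V0 ->
                (2 * #|[set b in Bp u | x \in b]| = T + 1)%N /\
                #|[set b in Bp u | x \in b]| = (2 ^ (t - 1))%N,
              forall x, x \in V0 -> one_factor (G u) (F x)
            & one_factorization V0 (G u) F]
      & (* (3) *)
        forall a b, a != 0 -> b != 0 -> a != b ->
          [/\ #|Bl [set a; b; a + b]| = ((T + 1) ^ 2)%N,
              #|Bl [set a; b; a + b]| = (2 ^ (2 * t))%N
            & transversal_design3 (T + 1)%N (G a) (G b) (G (a + b))
                (Bl [set a; b; a + b])]].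
Proof.
have /andP[t1 tn] := ht.
have le_tn : (t <= n)%N by apply: leq_trans tn (leq_subr _ _).
have t2 : (0 < 2 ^ t)%N by rewrite expn_gt0.
(* Each index is labelled by its column; the classes [G u] are then the fibers of [phi] by
   definition. *)
pose phi j := col j Hnt.
have sumB b : b \in B -> \sum_(j in b) phi j = 0.
  by move=> Bb; apply: sum_weight3_support; apply: (subsetP hBD).
have addUU := @F2_col_addxx (n - t).
move=> T V0 G.
have GE : G = fiber phi by [].
have T1 : (T + 1 = 2 ^ t)%N by rewrite subnK.
have cardG u : u != 0 -> #|fiber phi u| = (T + 1)%N.
  by move=> u0; rewrite T1 -GE (card_col_class _ le_tn hH hHnt) (negPf u0) subn0.
have cardV0 : #|fiber phi 0| = T.
  by rewrite -GE (card_col_class _ le_tn hH hHnt) eqxx.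
have neq02 (u : 'cV['F_2]_(n - t)) : u != 0 -> [set 0] != [set 0; u].
  by move=> u0; apply/eqP=> /setP/(_ u); rewrite !inE eqxx orbT (negPf u0).
have notin0 l : l \in pg_lines (n - t) -> 0 \notin l.
  rewrite inE => /existsP[a /existsP[b /and4P[a0 b0 ab /eqP->]]].
  by apply/negP=> /(line_neq0 addUU a0 b0 ab); rewrite eqxx.
(* Containing 0 separates the label sets [{0}] and [{0, u}] from every line. *)
have neql (X l : {set 'cV['F_2]_(n - t)}) : 0 \in X -> l \in pg_lines (n - t) -> X != l.
  by move=> X0 /notin0; apply: contraNneq => <-.
exists (blocks_over phi B [set 0]), (fun u => blocks_over phi B [set 0; u]),
  (blocks_over phi B).
split; split.
- apply/setP=> b; rewrite !in_setU; apply/idP/orP => [Bb | ].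
    have [-> | [u u0 Bu] | [u [v [u0 v0 uv Bl]]]] := blockP addUU hB sumB Bb.
    + by left.
    + by left; apply/orP; right; apply/bigcupP; exists u.
    right; apply/bigcupP; exists [set u; v; u + v] => //.
    by rewrite inE; apply/existsP; exists u; apply/existsP; exists v; apply/and4P.
  by case=> [/orP[|/bigcupP[u _]]|/bigcupP[l _]]; apply: in_blocks_over.
- split=> [u u0 | l Ll]; apply: disjoint_blocks_over; first exact: neq02.
  by apply: neql => //; rewrite inE.
- move=> u v u0 v0 uv; apply: disjoint_blocks_over.
  by apply: contraNneq uv => /setP/(_ u); rewrite !inE (negPf u0) eqxx => /esym.
- by move=> u l u0 Ll; apply: disjoint_blocks_over; apply: neql => //; rewrite !inE eqxx.
- by move=> l k _ _; apply: disjoint_blocks_over.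
- split; last exact: steiner_over0.
  by rewrite (card_blocks_over0 addUU hB sumB) cardV0.
- move=> u u0 F; split.
  + by rewrite (card_blocks_over2 addUU hB sumB) // cardV0 cardG.
  + by move=> b; apply: (block_over2P addUU hB sumB).
  + move=> x xV0; have := card_blocks_over2_at addUU hB sumB u0 xV0.
    rewrite cardG // => E2; split=> //; apply/eqP.
    (* Halving [T + 1 = 2 ^ t] to [2 ^ (t - 1)] relies on [1 <= t], since subtraction is
       truncated. *)
    by rewrite -(eqn_pmul2l (isT : 0 < 2)%N) E2 T1 -expnS subn1 prednK.
  + by move=> x; apply: (one_factor_over2 addUU hB sumB).
  exact: (one_factorization_over2 addUU hB sumB).
move=> a b a0 b0 ab.
have cardl := card_blocks_over_line addUU hB sumB a0 b0 ab.
rewrite !cardG // in cardl.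
split; first by rewrite cardl mulnn.
  by rewrite cardl mulnn T1 -expnM mulnC.
exact: (transversal_over_line addUU hB sumB).
Qed.
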